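(* Let $k > 2$, $C > 0$ and $V > 0$. There exists a constant $Q < \infty$, depending only on $(C, k, V)$, such that the following holds for all $\sigma > 0$ and all probability distributions $G_0, G_1$ on $\mathbb{R}$ satisfying: (i) $G_0$ and $G_1$ both have mean zero and variance at most $V$; (ii) (writing $G_1(\cdot)$ also for the cumulative distribution function of $G_1$) for all $s > 0$, $$\max\left(1 - G_1(s),\; G_1(-s)\right) \le C\, s^{-k},$$ and the posterior second moment $\mathbb{E}_{G_1}[\theta^2 \mid X]$ exists for almost every $X$. Then $$ \mathbb{E}_{G_0}\left[\left(\mathbb{E}_{G_1}[\theta \mid X]\right)^2\right] \le Q . $$
   Context: For $\theta \in \mathbb{R}$ and $\sigma>0$, let $f_X(x \mid \theta) = \frac{1}{\sqrt{2\pi}\,\sigma} \exp\left(-\frac{(x-\theta)^2}{2\sigma^2}\right)$ be the density of the likelihood $X \mid \theta \sim N(\theta, \sigma^2)$. For a probability distribution (prior) $G$ on $\mathbb{R}$ and a function $h$, $\mathbb{E}_{G}[h(\theta) \mid X]$ denotes the posterior expectation of $h(\theta)$ under prior $\theta \sim G$ and likelihood $X\mid\theta \sim N(\theta,\sigma^2)$, that is, the function of the data given by $$\mathbb{E}_{G}[h(\theta) \mid X = x] = \frac{\int h(\theta) f_X(x\mid\theta)\,G(d\theta)}{\int f_X(x\mid\theta)\,G(d\theta)}, \quad x \in \mathbb{R}.$$ In particular $\mathbb{E}_{G}[\theta \mid X]$ is the posterior mean. The outer expectation $\mathbb{E}_{G_0}[\cdot]$ is taken with $\theta \sim G_0$ and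 $X \mid \theta \sim N(\theta, \sigma^2)$, so that $X$ has marginal law $N(0,\sigma^2) \star G_0$ (convolution). Thus the quantity in the conclusion is the squared $L^2$-norm of the function $x \mapsto \mathbb{E}_{G_1}[\theta \mid X = x]$ under the law $N(0,\sigma^2)\star G_0$. ''Almost every $X$'' may be understood with respect to Lebesgue measure, which is equivalent to any such marginal law. The constant $Q$ must not depend on $\sigma$, $G_0$ or $G_1$ other than through $(C,k,V)$. *)

(* Defs.v *)
From HB Require Import structures.
From mathcomp Require Import all_boot all_order all_algebra.
From mathcomp Require Import all_classical all_reals all_analysis.

Set Implicit Arguments.
Unset Strict Implicit.
Unset Printing Implicit Defensive.

Import Order.TTheory GRing.Theory Num.Theory.
Import numFieldNormedType.Exports.

Local Open Scope classical_set_scope.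
Local Open Scope ring_scope.

(* [normal_pdf t sigma x] is the density at [x] of N(t, sigma^2): the second
   argument is the mean and the third the standard deviation, so below [t]
   (the parameter) is integrated and [x] (the datum) is held fixed. *)
Definition posterior_expectation (R : realType)
    (G : probability (measurableTypeR R) R) (sigma : R) (h : R -> R) (x : R)
    : R :=
  (\int[G]_t (h t * normal_pdf t sigma x)) / (\int[G]_t normal_pdf t sigma x).

(* The denominator of the posterior is always positive and finite when
   [0 < sigma], so existence only concerns the numerator. *)
Definition posterior_expectation_exists (R : realType)
    (G : probability (measurableTypeR R) R) (sigma : R) (h : R -> R) (x : R)
    : Prop :=
  G.-integrable setT (fun t => (h t * normal_pdf t sigma x)%:E).

(* Expectation of [g X] when the parameter has law [G] and, given [t], the
   datum [X] has law N(t, sigma^2); [+oo] is allowed for nonnegative [g]. *)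
Definition marginal_expectation (R : realType)
    (G : probability (measurableTypeR R) R) (sigma : R) (g : R -> R)
    : \bar R :=
  (\int[G]_t 'E_(normal_prob t sigma)[g])%E.

(* [idfun] carries no measurable-function instance in the library, so the
   parameter, seen as a random variable under its own law, gets a name. *)
Definition parameter (R : realType) : measurableTypeR R -> R := idfun.

HB.instance Definition _ (R : realType) :=
  @isMeasurableFun.Build _ _ _ _ (@parameter R) (@measurable_id _ _ setT).

Definition law_cdf (R : realType) (G : probability (measurableTypeR R) R)
    (s : R) : \bar R :=
  cdf (@parameter R : {RV G >-> R}) s.

(* Main.v *)
Require Import Defs.
From mathcomp Require Import all_boot all_order all_algebra.
From mathcomp Require Import all_classical all_reals all_analysis.
From mathcomp Require Import measurable_realfun ring lra.
Import Order.TTheory GRing.Theory Num.Theory.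
Import numFieldNormedType.Exports.
Local Open Scope classical_set_scope.
Local Open Scope ring_scope.

(* The square of the posterior mean m(x) is at most the posterior second moment,
   which is bounded in two ways. With W(t) = (x - t)^2 / (2 sigma^2), the
   weights exp(-W) decrease in (x - t)^2, so Chebyshev's association inequality
   gives E[(t - x)^2 | x] <= V + x^2, hence m(x)^2 <= 4 x^2 + 2 V. On the other
   hand, as G1 is centred, Jensen bounds the normalising constant below by
   exp(-(V + x^2) / (2 sigma^2)), so for 2 < q < k the posterior q-th moment is
   at most M_q exp((V + x^2) / (2 sigma^2)) and, for sigma >= 1,
   m(x)^2 <= K exp(x^2 / (q sigma^2)). Since q > 2 this is integrable against
   N(t, sigma^2), uniformly in |t| <= sigma. If sigma < 1 or |t| > sigma, then
   sigma^2 <= 1 + t^2 and the quadratic bound suffices. In all cases the inner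
   expectation is at most a + b t^2, which is then integrated against G0. *)

(** * Integration tools and the normal law *)

(** The integral of a nonnegative function is a supremum over the simple functions below it, so
    enlarging the function enlarges the family. This avoids proving measurability of the posterior
    mean in [x] and of its expectation in [t]. *)
Lemma le_integral_nonmeasurable {d : measure_display} {T : measurableType d}
    {R : realType} (mu : {measure set T -> \bar R}) (f g : T -> \bar R) :
  (forall x, 0 <= f x)%E -> (forall x, f x <= g x)%E ->
  (\int[mu]_x f x <= \int[mu]_x g x)%E.
Proof.
move=> f0 fg; have g0 x : (0 <= g x)%E := le_trans (f0 x) (fg x).
rewrite !ge0_integralTE//; apply: le_ereal_sup => _ [h hf <-].
by exists h => // x; exact: le_trans (hf x) (fg x).
Qed.

(** The Radon-Nikodym derivative of the normal law and [normal_pdf] have the same integral over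
    every measurable set, hence agree almost everywhere. *)
Lemma ge0_integral_normal_prob {R : realType} (t s : R)
    (f : R -> \bar R) :
  measurable_fun [set: R] f -> (forall x, 0 <= f x)%E ->
  (\int[normal_prob t s]_x f x =
   \int[lebesgue_measure]_x (f x * (normal_pdf t s x)%:E))%E.
Proof.
move=> mf f0.
have dom := @normal_prob_dominates R t s.
rewrite -(Radon_Nikodym_SigmaFinite.change_of_variables dom)//.
have mg := measurable_int _ (Radon_Nikodym_SigmaFinite.f_integrable dom).
have mp : measurable_fun setT (fun x : R => (normal_pdf t s x)%:E).
  by apply/measurable_EFinP; exact: measurable_normal_pdf.
apply: ae_eq_integral => //; [exact: emeasurable_funM..|].
apply/ae_eqe_mul2l/integral_ae_eq => //.
- exact: Radon_Nikodym_SigmaFinite.f_integrable.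
- by move=> A _ mA; rewrite -Radon_Nikodym_SigmaFinite.f_integral.
Qed.

Lemma integral_normal_prob_expR_sqr {R : realType} (t s b : R) :
  0 < s -> b < 2^-1 ->
  (\int[normal_prob t s]_x (expR (b * ((x - t) / s) ^+ 2))%:E =
   (Num.sqrt (1 - 2 * b))^-1%:E)%E.
Proof.
move=> s0 b2.
have r0 : 0 < 1 - 2 * b by rewrite subr_gt0; lra.
have q0 : 0 < Num.sqrt (1 - 2 * b) by rewrite sqrtr_gt0.
rewrite ge0_integral_normal_prob; last 2 first.
- apply/measurable_EFinP/measurableT_comp => //.
  apply/measurable_funM => //; apply/measurable_funX => //.
  by apply/measurable_funM => //; exact: measurable_funB.
- by move=> x; rewrite lee_fin expR_ge0.
(* The exponential tilt of the density of N(t, s^2) is a multiple of the density of N(t, s'^2),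
   which has total mass 1; the ratio of the peaks gives the value. *)
set s' := s / Num.sqrt (1 - 2 * b).
have s'0 : 0 < s' by rewrite divr_gt0.
rewrite (eq_integral (fun x : measurableTypeR R => (Num.sqrt (1 - 2 * b))^-1%:E
    * (normal_pdf t s' x)%:E)%E); last first.
  move=> x _; rewrite -!EFinM; congr (_%:E).
  rewrite !normal_pdfE ?gt_eqF// /normal_peak mulrCA [RHS]mulrA; congr (_ * _).
    rewrite /s' expr_div_n sqr_sqrtr ?(ltW r0)//.
    rewrite -invfM; congr (_^-1).
    rewrite -sqrtrM ?(ltW r0)//; congr Num.sqrt.
    by field; rewrite gt_eqF.
  rewrite /normal_fun -expRD; congr expR.
  rewrite /s' !expr_div_n sqr_sqrtr ?(ltW r0)//.
  by field; rewrite !gt_eqF.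
rewrite ge0_integralZl//; last 2 first.
- by apply/measurable_EFinP; exact: measurable_normal_pdf.
- by move=> x _; rewrite lee_fin normal_pdf_ge0.
by rewrite integral_normal_pdf mule1.
Qed.

(** * Moments of the prior *)

Lemma integral_sqr_le_variance {R : realType}
    (G : probability (measurableTypeR R) R) (V : R) :
  ('E_G[@parameter R] = 0)%E -> ('V_G[@parameter R] <= V%:E)%E ->
  (\int[G]_t (t ^+ 2)%:E <= V%:E)%E.
Proof.
move=> E0; rewrite /variance unlock E0 /= => VG.
rewrite (le_trans _ VG)// expectation.unlock le_eqVlt; apply/orP; left.
apply/eqP; apply: eq_integral => t _. 
by rewrite [in LHS]expr2 -[t in LHS]subr0.
Qed.

Lemma integrable_sqr {R : realType}
    (G : probability (measurableTypeR R) R) (V : R) :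
  (\int[G]_t (t ^+ 2)%:E <= V%:E)%E ->
  G.-integrable setT (fun t => (t ^+ 2)%:E).
Proof.
move=> GV; apply/integrableP; split.
  by apply/measurable_EFinP; exact: measurable_funX.
rewrite (le_lt_trans _ (ltry V))// (le_trans _ GV)//.
by apply: le_integral_nonmeasurable => t /=; rewrite lee_fin ?ger0_norm ?sqr_ge0.
Qed.

Lemma integrable_id {R : realType} (G : probability (measurableTypeR R) R) :
  G.-integrable setT (fun t => (t ^+ 2)%:E) ->
  G.-integrable setT (fun t => t%:E).
Proof.
move=> G2; have G1 : G.-integrable setT (cst 1%E).
  by apply: finite_measure_integrable_cst.
apply: (le_integrable _ _ _ (integrableD _ G1 G2)) => //.
  by apply/measurable_EFinP.
move=> t _ /=; rewrite lee_fin [leRHS]ger0_norm ?addr_ge0 ?sqr_ge0//.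
have := sqr_ge0 (`|t| - 1); rewrite sqrrB expr1n real_normK ?num_real//.
by have := normr_ge0 t; lra.
Qed.

Lemma measurable_norm_gt {R : realType} (r : R) :
  measurable ([set t | r < `|t|] : set (measurableTypeR R)).
Proof.
rewrite (_ : mkset _ = setT `&` (fun t : R => `|t|) @^-1` `]r, +oo[%classic).
  exact: (normr_measurable measurableT).
by rewrite setTI; apply/seteqP; split => t /=; rewrite in_itv/= andbT.
Qed.

(** The constant 1 covers [|t| <= 1]. Otherwise 2^m < |t| <= 2^(m+1) for some m, and the term of
    index m alone is already at least |t|^q. *)
Lemma powR_le_dyadic_sum {R : realType} (q t : R) : 0 < q ->
  ((`|t| `^ q)%:E <= 1 + \sum_(n <oo)
     ((2 `^ q) ^+ n.+1 * \1_[set u : R | 2 ^+ n < `|u|] t)%:E)%E.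
Proof.
move=> q0.
have term_ge0 n : (0 <=
    ((2 `^ q) ^+ n.+1 * \1_[set u : R | (2 ^+ n < `|u|)%R] t)%:E)%E.
  by rewrite lee_fin mulr_ge0// exprn_ge0// powR_ge0.
have [t1|t1] := leP `|t| 1.
  rewrite -[leLHS]adde0 leeD ?nneseries_ge0// lee_fin.
  rewrite -[leRHS](congr1 (fun f => f q) (@powR1 R)).
  by apply: ge0_ler_powR; rewrite ?nnegrE//; exact: ltW.
have [N tN] : exists n, `|t| <= 2 ^+ n.
  by exists (Num.bound `|t|); exact/ltW/upper_nthrootP.
have : exists n, `|t| <= 2 ^+ n by exists N.
move=> /ex_minnP[m tm mmin].
case: m tm mmin => [|m] tm mmin; first by rewrite expr0 leNgt t1 in tm.
have mt : 2 ^+ m < `|t|.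
  by rewrite ltNge; apply/negP => /mmin; rewrite ltnn.
apply: (@le_trans _ _ ((2 `^ q) ^+ m.+1 * \1_[set u : R | 2 ^+ m < `|u|] t)%:E).
  rewrite indicE mem_set// mulr1 lee_fin.
  rewrite -powR_mulrn ?powR_ge0// -powRrM mulrC powRrM powR_mulrn//.
  by apply: ge0_ler_powR; rewrite ?nnegrE ?exprn_ge0// ltW.
rewrite -[leLHS]add0e leeD//.
apply: le_trans (nneseries_lim_ge m.+1 _) => //.
rewrite big_nat_recr//= -[leLHS]add0e leeD//.
by apply: sume_ge0 => n _.
Qed.

(** Integrating the dyadic bound termwise, the n-th term is at most 2^(q(n+1)) C 2^(-kn) = C 2^q
    (2^(q-k))^n, a geometric series of ratio below 1 since [q < k]. *)
Lemma moment_le_tail {R : realType} (G : probability (measurableTypeR R) R)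
    (C k q : R) : 0 <= C -> 0 < q -> q < k ->
  (forall s : R, 0 < s -> (G [set t : R | (s < `|t|)%R] <= (C * s `^ (- k))%:E)%E) ->
  (\int[G]_t (`|t| `^ q)%:E <=
     (1 + C * 2 `^ q / (1 - 2 `^ (q - k)))%:E)%E.
Proof.
move=> C0 q0 qk tail.
have mA n := measurable_norm_gt (2 ^+ n : R).
have mterm n : measurable_fun setT (fun t : measurableTypeR R =>
    ((2 `^ q) ^+ n.+1 * \1_[set u : R | 2 ^+ n < `|u|] t)%:E).
  by apply/measurable_EFinP/measurable_funM.
have term_ge0 n (t : measurableTypeR R) : (0 <=
    ((2 `^ q) ^+ n.+1 * \1_[set u : R | (2 ^+ n < `|u|)%R] t)%:E)%E.
  by rewrite lee_fin mulr_ge0// exprn_ge0// powR_ge0.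
apply: le_trans.
  apply: le_integral_nonmeasurable; last first.
    by move=> t; exact: powR_le_dyadic_sum.
  by move=> t; rewrite lee_fin powR_ge0.
rewrite ge0_integralD//; last 2 first.
- by move=> t _; exact: nneseries_ge0.
- exact: ge0_emeasurable_sum.
rewrite integral_cst//= probability_setT mule1 EFinD leeD//.
rewrite integral_nneseries//.
set z := 2 `^ (q - k).
have z0 : 0 < z by exact: powR_gt0.
have z1 : z < 1.
  by rewrite /z /powR pnatr_eq0/= expR_lt1 nmulr_rlt0 ?subr_lt0// ln_gt0 ?ltr1n.
apply: (@le_trans _ _ (\sum_(n <oo) (geometric (C * 2 `^ q) z n)%:E)%E).
  apply: lee_nneseries => n *; first exact: integral_ge0.
  under eq_integral do rewrite EFinM.
  rewrite ge0_integralZl//; last first.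
    by apply/measurable_EFinP; exact: measurable_indic.
  rewrite integral_indic// setIT.
  apply: le_trans (lee_wpmul2l _ (tail (2 ^+ n) _)) _.
  - by rewrite lee_fin exprn_ge0// powR_ge0.
  - by rewrite exprn_gt0.
  rewrite -EFinM lee_fin /= /z powRD; last by rewrite pnatr_eq0 implybT.
  rewrite exprMn -(powR_mulrn n)// powRAC powR_mulrn ?powR_ge0// exprS.
  by rewrite le_eqVlt; apply/orP; left; apply/eqP; ring.
apply: lime_le.
  apply: is_cvg_nneseries => n _ _.
  by rewrite lee_fin mulr_ge0 ?mulr_ge0 ?powR_ge0 ?exprn_ge0// ltW.
apply: nearW => n; rewrite sumEFin lee_fin.
apply: geometric_le_lim => //; first by rewrite mulr_ge0 ?powR_ge0.
by rewrite ger0_norm// ltW.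
Qed.

(** * Linear combinations and weighting by the normal density *)

Lemma integrableZl_EFin {d : measure_display} {T : measurableType d}
    {R : realType} (mu : {measure set T -> \bar R}) (k : R) (f : T -> R) :
  mu.-integrable setT (EFin \o f) ->
  mu.-integrable setT (fun t => (k * f t)%:E).
Proof. by move=> If; exact: eq_integrable (integrableZl measurableT k If). Qed.

Lemma integrable_lin3 {d : measure_display} {T : measurableType d}
    {R : realType} (mu : {measure set T -> \bar R}) (f g h : T -> R)
    (a b c : R) :
  mu.-integrable setT (EFin \o f) -> mu.-integrable setT (EFin \o g) ->
  mu.-integrable setT (EFin \o h) ->
  mu.-integrable setT (fun t => (a * f t + b * g t + c * h t)%:E).
Proof.
move=> If Ig Ih.
have IZ := @integrableZl_EFin _ _ _ mu.
apply: eq_integrable (integrableD measurableT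
  (integrableD measurableT (IZ a f If) (IZ b g Ig)) (IZ c h Ih)) => //.
Qed.

Lemma Rintegral_lin3 {d : measure_display} {T : measurableType d}
    {R : realType} (mu : {measure set T -> \bar R}) (f g h : T -> R)
    (a b c : R) :
  mu.-integrable setT (EFin \o f) -> mu.-integrable setT (EFin \o g) ->
  mu.-integrable setT (EFin \o h) ->
  \int[mu]_t (a * f t + b * g t + c * h t) =
  a * \int[mu]_t f t + b * \int[mu]_t g t + c * \int[mu]_t h t.
Proof.
move=> If Ig Ih.
have IZ := @integrableZl_EFin _ _ _ mu.
rewrite RintegralD//; last 2 first.
- exact: (integrableD measurableT (IZ a f If) (IZ b g Ig)).
- exact: IZ.
by rewrite RintegralD//; [|exact: IZ..]; rewrite !RintegralZl.
Qed.

(** Exchanging mean and datum turns measurability in the parameter into measurability of a fixed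
    density. *)
Lemma normal_pdf_sym {R : realType} (t s x : R) : s != 0 ->
  normal_pdf t s x = normal_pdf x s t.
Proof.
by move=> s0; rewrite !normal_pdfE// /normal_fun -(opprB t x) sqrrN.
Qed.

Lemma integrable_mul_normal_pdf {R : realType}
    (G : probability (measurableTypeR R) R) (s x : R) (h : R -> R) :
  s != 0 -> G.-integrable setT (EFin \o h) ->
  G.-integrable setT (fun t => (h t * normal_pdf t s x)%:E).
Proof.
move=> s0 Ih.
apply: le_integrable (integrableZl measurableT (normal_peak s) Ih) => //.
  apply/measurable_EFinP/measurable_funM.
    by apply/measurable_EFinP; exact: measurable_int Ih.
  under eq_fun do rewrite normal_pdf_sym//.
  exact: measurable_normal_pdf.
move=> t _; rewrite -EFinM !abse_EFin lee_fin !normrM mulrC.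
rewrite ler_wpM2r// !ger0_norm ?normal_peak_ge0 ?normal_pdf_ge0//.
exact: normal_pdf_ub.
Qed.

Lemma integrable_cst1 {R : realType}
    (G : probability (measurableTypeR R) R) :
  G.-integrable setT (EFin \o cst 1).
Proof. by apply: finite_measure_integrable_cst. Qed.

Lemma Rintegral_cst1 {R : realType} (G : probability (measurableTypeR R) R) :
  \int[G]_t cst 1 t = 1.
Proof. by rewrite Rintegral_cst//= probability_setT mul1r. Qed.

Lemma integrable_normal_pdf_mean {R : realType}
    (G : probability (measurableTypeR R) R) (s x : R) : s != 0 ->
  G.-integrable setT (EFin \o (fun t => normal_pdf t s x)).
Proof.
move=> s0.
apply: eq_integrable
  (integrable_mul_normal_pdf _ _ x _ s0 (integrable_cst1 G)) => //.
by move=> t _; rewrite /= mul1r.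
Qed.

(** * Pointwise bounds on the posterior *)

(** The posterior variance is nonnegative: expanding the integral of (t - m)^2 against the weights
    leaves the unnormalised second moment minus m^2 D. *)
Lemma posterior_mean_sqr_le {R : realType}
    (G : probability (measurableTypeR R) R) (s x B : R) :
  0 < s -> G.-integrable setT (fun t => (t ^+ 2)%:E) ->
  0 < \int[G]_t normal_pdf t s x ->
  \int[G]_t (t ^+ 2 * normal_pdf t s x) <= B * \int[G]_t normal_pdf t s x ->
  posterior_expectation G s (fun t => t) x ^+ 2 <= B.
Proof.
move=> s0 I2 D0 DB; have s1 : s != 0 by rewrite gt_eqF.
have I1 := integrable_id _ I2.
have I0 := integrable_cst1 G.
have J0 := integrable_normal_pdf_mean G _ x s1.
have J1 := integrable_mul_normal_pdf _ _ x _ s1 I1.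
have J2 := integrable_mul_normal_pdf _ _ x _ s1 I2.
rewrite /posterior_expectation.
set N := \int[G]_t (t * _); set D := \int[G]_t normal_pdf _ _ _ in D0 DB *.
set m := N / D.
have : 0 <= \int[G]_t (1 * (t ^+ 2 * normal_pdf t s x)
    + (- 2 * m) * (t * normal_pdf t s x) + m ^+ 2 * normal_pdf t s x).
  apply: Rintegral_ge0 => t _.
  rewrite (_ : _ + _ = (t - m) ^+ 2 * normal_pdf t s x); last by ring.
  by rewrite mulr_ge0 ?sqr_ge0 ?normal_pdf_ge0.
rewrite Rintegral_lin3//= -/N -/D mul1r.
have -> : N = m * D by rewrite /m divfK// gt_eqF.
move=> h; rewrite -(ler_pM2r D0) (le_trans _ DB)// -subr_ge0.
by move: h; congr (_ <= _); ring.
Qed.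

Lemma normal_evidence_ge {R : realType}
    (G : probability (measurableTypeR R) R) (s x V : R) :
  0 < s -> G.-integrable setT (fun t => (t ^+ 2)%:E) ->
  \int[G]_t t = 0 -> \int[G]_t (t ^+ 2) <= V ->
  normal_peak s * expR (- ((V + x ^+ 2) / (s ^+ 2 *+ 2)))
    <= \int[G]_t normal_pdf t s x.
Proof.
move=> s0 I2 E1 E2; have s1 : s != 0 by rewrite gt_eqF.
have I1 := integrable_id _ I2.
have I0 := integrable_cst1 G.
have J0 := integrable_normal_pdf_mean G _ x s1.
set c := (V + x ^+ 2) / (s ^+ 2 *+ 2); set K := normal_peak s * expR (- c).
have K0 : 0 <= K by rewrite mulr_ge0 ?normal_peak_ge0 ?expR_ge0.
set r := (s ^+ 2 *+ 2)^-1.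
have r0 : 0 < r by rewrite invr_gt0 pmulrn_rgt0// exprn_gt0.
(* Jensen by hand: the right side is the integral of the minorant K (1 + c - r (x - t)^2) of the
   density, from exp(y) >= 1 + y, with first moment 0 and second moment replaced by [V]. *)
have -> : K = K * (1 + V * r) * \int[G]_t (cst 1 t) + K * r * 2 * x * 0
    + - (K * r) * V.
  by rewrite Rintegral_cst1; ring.
rewrite -E1; apply: (@le_trans _ _ (\int[G]_t (K * (1 + V * r) * cst 1 t
    + K * r * 2 * x * t + - (K * r) * t ^+ 2))).
  rewrite Rintegral_lin3// lerD2l !mulNr lerN2.
  by rewrite ler_wpM2l// mulr_ge0// ltW.
apply: le_Rintegral => //; first exact: integrable_lin3.
move=> t _; rewrite normal_pdfE// /normal_fun.
have -> : - (x - t) ^+ 2 / (s ^+ 2 *+ 2) = - c + (c - (x - t) ^+ 2 * r).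
  by rewrite /r; ring.
rewrite expRD [leRHS]mulrA -/K.
apply: le_trans _ (ler_wpM2l K0 (expR_ge1Dx _)).
rewrite le_eqVlt; apply/orP; left; apply/eqP.
by rewrite /c -/r /cst; ring.
Qed.

Lemma posterior_second_moment_quadratic {R : realType}
    (G : probability (measurableTypeR R) R) (s x V : R) :
  0 < s -> G.-integrable setT (fun t => (t ^+ 2)%:E) ->
  \int[G]_t t = 0 -> \int[G]_t (t ^+ 2) <= V ->
  \int[G]_t (t ^+ 2 * normal_pdf t s x)
    <= (4 * x ^+ 2 + 2 * V) * \int[G]_t normal_pdf t s x.
Proof.
move=> s0 I2 E1 E2; have s1 : s != 0 by rewrite gt_eqF.
have I1 := integrable_id _ I2.
have I0 := integrable_cst1 G.
have J0 := integrable_normal_pdf_mean G _ x s1.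
have J2 := integrable_mul_normal_pdf _ _ x _ s1 I2.
(* [K] is the weight at (x - t)^2 = V + x^2, where the decreasing weight crosses its threshold. *)
set c := (V + x ^+ 2) / (s ^+ 2 *+ 2); set K := normal_peak s * expR (- c).
have K0 : 0 <= K by rewrite mulr_ge0 ?normal_peak_ge0 ?expR_ge0.
set r := (s ^+ 2 *+ 2)^-1.
have r0 : 0 < r by rewrite invr_gt0 pmulrn_rgt0// exprn_gt0.
have IP := integrable_lin3 G _ _ _ (2 * K) (- (4 * x * K)) (- (2 * V * K))
  I2 I1 I0.
have IB : G.-integrable setT
    (EFin \o (fun t => (4 * x ^+ 2 + 2 * V) * normal_pdf t s x)).
  exact: eq_integrable (integrableZl measurableT _ J0).
(* The polynomial is 2 K ((x - t)^2 - (V + x^2)), whose integral is at most 0. The pointwise bound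
   combines the opposite signs of (x - t)^2 - (V + x^2) and w - K with t^2 <= 2 (x - t)^2 + 2
   x^2. *)
apply: (@le_trans _ _ (\int[G]_t ((2 * K * t ^+ 2 + - (4 * x * K) * t
    + - (2 * V * K) * cst 1 t) + (4 * x ^+ 2 + 2 * V) * normal_pdf t s x))).
  apply: le_Rintegral => //.
    exact: eq_integrable (integrableD measurableT IP IB).
  move=> t _.
  set w := normal_pdf t s x.
  suff : ((x - t) ^+ 2 - (V + x ^+ 2)) * (w - K) <= 0.
    rewrite -subr_ge0 sub0r => h; rewrite -subr_ge0.
    have w0 : 0 <= w by exact: normal_pdf_ge0.
    have := mulr_ge0 (sqr_ge0 (t - 2 * x)) w0.
    rewrite /cst; move: h; nra.
  have wE : w = normal_peak s * expR (- ((x - t) ^+ 2 * r)).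
    by rewrite /w normal_pdfE// /normal_fun mulNr.
  have [le|/ltW ge] := leP ((x - t) ^+ 2) (V + x ^+ 2).
    rewrite mulr_le0_ge0 ?subr_le0 ?subr_ge0//.
    rewrite wE ler_wpM2l ?normal_peak_ge0// ler_expR lerN2 /c -/r.
    by rewrite ler_wpM2r// ltW.
  rewrite mulr_ge0_le0 ?subr_le0 ?subr_ge0//.
  rewrite wE ler_wpM2l ?normal_peak_ge0// ler_expR lerN2 /c -/r.
  by rewrite ler_wpM2r// ltW.
rewrite RintegralD// RintegralZl// gerDr Rintegral_lin3// E1 Rintegral_cst1.
rewrite (_ : _ + _ = 2 * K * (\int[G]_t t ^+ 2 - V)); last by ring.
apply: mulr_ge0_le0; first exact: mulr_ge0.
by rewrite subr_le0.
Qed.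

(** Truncation at |t| = exp(l): below it t^2 <= exp(2 l); above it t^2 <= exp((2 - q) l) |t|^q, and
    the density is bounded by its peak. *)
Lemma posterior_second_moment_exp {R : realType}
    (G : probability (measurableTypeR R) R) (s x V q M : R) :
  0 < s -> 2 < q -> 0 < M ->
  G.-integrable setT (fun t => (t ^+ 2)%:E) ->
  \int[G]_t t = 0 -> \int[G]_t (t ^+ 2) <= V ->
  (\int[G]_t (`|t| `^ q)%:E <= M%:E)%E ->
  \int[G]_t (t ^+ 2 * normal_pdf t s x)
    <= 2 * expR (2 / q * (ln M + (V + x ^+ 2) / (s ^+ 2 *+ 2)))
       * \int[G]_t normal_pdf t s x.
Proof.
move=> s0 q2 M0 I2 E1 E2 EM; have s1 : s != 0 by rewrite gt_eqF.
have q0 : 0 < q by lra.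
have J0 := integrable_normal_pdf_mean G _ x s1.
have J2 := integrable_mul_normal_pdf _ _ x _ s1 I2.
have Iq : G.-integrable setT (EFin \o (fun t => `|t| `^ q)).
  apply/integrableP; split.
    apply/measurable_EFinP.
    apply: (measurableT_comp (f := fun y : R => y `^ q)).
      exact: measurable_powR.
    exact: normr_measurable.
  rewrite (le_lt_trans _ (ltry M))// (le_trans _ EM)//.
  apply: le_integral_nonmeasurable => t; first exact: abse_ge0.
  by rewrite /= lee_fin ger0_norm// powR_ge0.
have EqM : \int[G]_t (`|t| `^ q) <= M.
  rewrite -lee_fin /Rintegral fineK//.
  by apply: integrable_fin_num.
have lower := normal_evidence_ge _ _ x _ s0 I2 E1 E2.
set c := (V + x ^+ 2) / (s ^+ 2 *+ 2) in lower *.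
set D := \int[G]_t normal_pdf _ _ _ in lower *.
(* This level makes M exp((2 - q) l) equal to exp(2 l - c), so the lower bound on [D] makes the
   outer part at most the inner one; hence the factor 2. *)
set l := (ln M + c) / q.
have -> : 2 / q * (ln M + c) = 2 * l by rewrite /l; ring.
have pt (t : R) : t ^+ 2 * normal_pdf t s x <=
    expR (2 * l) * normal_pdf t s x
    + normal_peak s * expR ((2 - q) * l) * `|t| `^ q.
  have [tl|tl] := leP `|t| (expR l).
    rewrite -[leLHS]addr0 lerD// ?mulr_ge0 ?normal_peak_ge0 ?expR_ge0 ?powR_ge0//.
    rewrite ler_wpM2r ?normal_pdf_ge0// -real_normK ?num_real//.
    by rewrite mulrC expRM -powR_mulrn// ge0_ler_powR ?nnegrE ?expR_ge0.
  rewrite -[leLHS]add0r lerD ?mulr_ge0 ?normal_pdf_ge0 ?expR_ge0//.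
  rewrite mulrC -mulrA ler_pM ?normal_pdf_ge0 ?sqr_ge0 ?normal_pdf_ub//.
  have t0 : 0 < `|t| by exact: lt_trans (expR_gt0 _) tl.
  rewrite -real_normK ?num_real// -powR_mulrn//.
  rewrite /powR gt_eqF// -expRD ler_expR.
  have : l <= ln `|t| by rewrite -ler_expR lnK ?posrE// ltW.
  by nra.
have I1 : G.-integrable setT
    (EFin \o (fun t => expR (2 * l) * normal_pdf t s x)).
  exact: eq_integrable (integrableZl measurableT _ J0).
have I3 : G.-integrable setT (EFin \o
    (fun t => normal_peak s * expR ((2 - q) * l) * `|t| `^ q)).
  exact: eq_integrable (integrableZl measurableT _ Iq).
apply: (@le_trans _ _ (expR (2 * l) * D
    + normal_peak s * expR ((2 - q) * l) * M)).
  apply: (@le_trans _ _ (\int[G]_t (expR (2 * l) * normal_pdf t s x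
      + normal_peak s * expR ((2 - q) * l) * `|t| `^ q))).
    apply: le_Rintegral => //.
    exact: eq_integrable (integrableD measurableT I1 I3).
  rewrite RintegralD// !RintegralZl// lerD2l ler_wpM2l//.
  by rewrite mulr_ge0 ?normal_peak_ge0 ?expR_ge0.
have -> : 2 * expR (2 * l) * D = expR (2 * l) * D + expR (2 * l) * D by ring.
rewrite lerD2l.
apply: le_trans _ (ler_wpM2l (expR_ge0 _) lower).
rewrite le_eqVlt; apply/orP; left; apply/eqP.
rewrite [RHS]mulrCA -[LHS]mulrA; congr (_ * _).
rewrite -[M in LHS](lnK (M0 : M \is Num.pos)) -!expRD; congr expR.
by rewrite /l; field; rewrite gt_eqF.
Qed.

(** * Expectations over the datum, and the tail of the prior *)

Lemma expectation_normal_prob_le {R : realType} (t s b K : R) (g : R -> R) :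
  0 < s -> b < 2^-1 -> (forall x, 0 <= g x) ->
  (forall x, g x <= K * expR (b * ((x - t) / s) ^+ 2)) ->
  ('E_(normal_prob t s)[g] <= (K / Num.sqrt (1 - 2 * b))%:E)%E.
Proof.
move=> s0 b2 g0 gK.
have K0 : 0 <= K.
  by rewrite -(pmulr_lge0 _ (expR_gt0 (b * ((0 - t) / s) ^+ 2))) (le_trans (g0 0)).
have mf : measurable_fun [set: R]
    (fun x : R => (expR (b * ((x - t) / s) ^+ 2))%:E).
  apply/measurable_EFinP/measurableT_comp => //.
  apply/measurable_funM => //; apply/measurable_funX => //.
  by apply/measurable_funM => //; exact: measurable_funB.
rewrite expectation.unlock EFinM -(integral_normal_prob_expR_sqr t s b)//.
rewrite -ge0_integralZl//.
apply: le_integral_nonmeasurable => x; first by rewrite lee_fin.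
by rewrite -EFinM lee_fin.
Qed.

(** A union bound over the two tails gives the factor 2; the left tail may include the point [- s],
    which only enlarges the cover. *)
Lemma tail_le_law_cdf {R : realType} (G : probability (measurableTypeR R) R)
    (s a : R) :
  (Order.max (1 - law_cdf G s) (law_cdf G (- s)) <= a%:E)%E ->
  (G [set t : R | (s < `|t|)%R] <= (2 * a)%:E)%E.
Proof.
rewrite ge_max => /andP[up down].
have mL r : measurable (`]-oo, r]%classic : set (measurableTypeR R)).
  exact: measurable_itv.
have -> : (2 * a)%:E = (a%:E + a%:E)%E by rewrite -EFinD; congr (_%:E); ring.
apply: le_trans (leeD up down).
have -> : (1 - law_cdf G s)%E = G (~` `]-oo, s]%classic).
  by rewrite probability_setC.
apply: le_trans (measureU2 _ (measurableC (mL s)) (mL (- s))).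
apply: le_measure; rewrite ?inE.
- exact: measurable_norm_gt.
- exact: measurableU (measurableC (mL s)) (mL (- s)).
- move=> t /=; rewrite !in_itv/= => st.
  move: st; rewrite lter_normr => /orP[st|st].
    by left; apply/negP; rewrite -ltNge.
  by right; rewrite lerNr ltW.
Qed.


(** * The inner expectation at a fixed parameter *)

Lemma expectation_posterior_mean_sqr_quadratic {R : realType}
    (G : probability (measurableTypeR R) R) (s t V : R) :
  0 < s -> G.-integrable setT (fun t => (t ^+ 2)%:E) ->
  \int[G]_t t = 0 -> \int[G]_t (t ^+ 2) <= V ->
  ('E_(normal_prob t s)[(fun x => posterior_expectation G s (fun t => t) x ^+ 2)%R]
   <= ((8 * t ^+ 2 + 2 * V + 32 * s ^+ 2) / Num.sqrt (1 - 2 * 4^-1))%:E)%E.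
Proof.
move=> s0 I2 E1 E2; have s1 : s != 0 by rewrite gt_eqF.
have V0 : 0 <= V by apply: le_trans E2; apply: Rintegral_ge0 => u _; exact: sqr_ge0.
apply: expectation_normal_prob_le => //; [lra|by move=> x; exact: sqr_ge0|].
move=> x; have D0 : 0 < \int[G]_u normal_pdf u s x.
  apply: lt_le_trans (normal_evidence_ge _ _ x _ s0 I2 E1 E2).
  by rewrite mulr_gt0 ?normal_peak_gt0 ?expR_gt0.
apply: le_trans (posterior_mean_sqr_le _ _ _ _ s0 I2 D0
  (posterior_second_moment_quadratic _ _ _ _ s0 I2 E1 E2)) _.
set z := (x - t) / s.
have -> : x = s * z + t by rewrite /z mulrC divfK// subrK.
have e1 := expR_ge1Dx (4^-1 * z ^+ 2).
set e := expR _ in e1 *.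
have s2 := sqr_ge0 s; have t2 := sqr_ge0 t; have z2 := sqr_ge0 z.
(* From 4 x^2 <= 8 t^2 + 8 s^2 z^2; the coefficient 32 absorbs 8 s^2 z^2 into the z^2 / 4 of the
   exponential bound. *)
apply: (@le_trans _ _ ((8 * t ^+ 2 + 2 * V + 32 * s ^+ 2) * (1 + 4^-1 * z ^+ 2))).
  have := sqr_ge0 (s * z - t); nra.
by rewrite ler_wpM2l// !addr_ge0// mulr_ge0.
Qed.

(** In standardised variables the exponent grows like (z + y)^2 / q with |y| <= 1. The coefficient
    (q + 2) / (4 q) given to z^2 is the midpoint of 1 / q and 1 / 2: it leaves room for the cross
    term and stays integrable. *)
Lemma expectation_posterior_mean_sqr_exp {R : realType}
    (G : probability (measurableTypeR R) R) (s t V q M : R) :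
  1 <= s -> `|t| <= s -> 2 < q -> 0 < M ->
  G.-integrable setT (fun t => (t ^+ 2)%:E) ->
  \int[G]_t t = 0 -> \int[G]_t (t ^+ 2) <= V ->
  (\int[G]_t (`|t| `^ q)%:E <= M%:E)%E ->
  ('E_(normal_prob t s)[(fun x => posterior_expectation G s (fun t => t) x ^+ 2)%R]
   <= (2 * expR (2 / q * (ln M + V / 2) + (q + 2) / (q * (q - 2)))
       / Num.sqrt (1 - 2 * ((q + 2) / (4 * q))))%:E)%E.
Proof.
move=> s1 ts q2 M0 I2 E1 E2 EM.
have s0 : 0 < s by lra.
have sN0 : s != 0 by rewrite gt_eqF.
have q0 : 0 < q by lra.
have V0 : 0 <= V by apply: le_trans E2; apply: Rintegral_ge0 => u _; exact: sqr_ge0.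
apply: expectation_normal_prob_le => //.
- by rewrite ltr_pdivrMr; lra.
- by move=> x; exact: sqr_ge0.
move=> x; have D0 : 0 < \int[G]_u normal_pdf u s x.
  apply: lt_le_trans (normal_evidence_ge _ _ x _ s0 I2 E1 E2).
  by rewrite mulr_gt0 ?normal_peak_gt0 ?expR_gt0.
apply: le_trans (posterior_mean_sqr_le _ _ _ _ s0 I2 D0
  (posterior_second_moment_exp _ _ _ _ _ _ s0 q2 M0 I2 E1 E2 EM)) _.
rewrite -[leRHS]mulrA ler_pM2l// -expRD ler_expR.
set z := (x - t) / s; set y := t / s.
have -> : x = s * (z + y) by rewrite /z /y; field.
have y1 : y ^+ 2 <= 1.
  by rewrite -real_normK ?num_real// expr_le1// /y normrM normfV (gtr0_norm s0)
    ler_pdivrMr// mul1r.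
have -> : 2 / q * (ln M + (V + (s * (z + y)) ^+ 2) / (s ^+ 2 *+ 2)) =
    2 / q * (ln M + V / 2 / s ^+ 2) + (z + y) ^+ 2 / q.
  by field; rewrite !gt_eqF.
rewrite -addrA lerD//.
  (* Here [1 <= s] removes the dependence on [s]. *)
  rewrite ler_pM2l ?divr_gt0// lerD2l ler_piMr ?divr_ge0//.
  by rewrite invf_le1 ?exprn_gt0// expr_ge1// ltW.
(* Young's inequality for [(z + y)^2] with weight [(q - 2) / 4] *)
have -> : (q + 2) / (q * (q - 2)) + (q + 2) / (4 * q) * z ^+ 2 =
   ((q + 2) / (q - 2) + (q + 2) / 4 * z ^+ 2) / q.
  by field; rewrite !gt_eqF//; lra.
rewrite ler_pM2r ?invr_gt0//.
have h0 : 0 < q - 2 by lra.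
apply: (@le_trans _ _ ((q + 2) / (q - 2) * y ^+ 2 + (q + 2) / 4 * z ^+ 2)).
  rewrite -subr_ge0 (_ : _ - _ = ((q - 2) * z - 4 * y) ^+ 2 / (4 * (q - 2))).
    by rewrite divr_ge0 ?sqr_ge0 ?mulr_ge0// ltW.
  by field; rewrite gt_eqF.
by rewrite lerD2r ler_piMr// divr_ge0// ltW//; lra.
Qed.

(** * Integration over the prior and conclusion *)

Lemma integral_affine_sqr_le {R : realType}
    (G : probability (measurableTypeR R) R) (a b V : R) :
  0 <= a -> 0 <= b -> (\int[G]_t (t ^+ 2)%:E <= V%:E)%E ->
  (\int[G]_t (a + b * t ^+ 2)%:E <= (a + b * V)%:E)%E.
Proof.
move=> a0 b0 GV; have I2 := integrable_sqr _ _ GV.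
have mS : measurable_fun [set: measurableTypeR R]
    (fun t : measurableTypeR R => (t ^+ 2)%:E).
  exact: measurable_int I2.
under eq_integral do rewrite EFinD EFinM.
rewrite ge0_integralD//; last first.
- exact: measurable_funeM.
- by move=> t _; rewrite -EFinM lee_fin mulr_ge0 ?sqr_ge0.
rewrite integral_cst//= probability_setT mule1 EFinD leeD2l//.
rewrite ge0_integralZl//; last by move=> t _; rewrite lee_fin sqr_ge0.
by rewrite EFinM lee_wpmul2l.
Qed.

Theorem theorem1 (R : realType) (C k V : R)
    (hk : 2 < k) (hC : 0 < C) (hV : 0 < V) :
  exists Q : R,
    forall (sigma : R) (G0 G1 : probability (measurableTypeR R) R),
      0 < sigma ->
      ('E_G0[@parameter R] = 0)%E -> ('V_G0[@parameter R] <= V%:E)%E ->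
      ('E_G1[@parameter R] = 0)%E -> ('V_G1[@parameter R] <= V%:E)%E ->
      (forall s : R, 0 < s ->
         (Order.max (1 - law_cdf G1 s) (law_cdf G1 (- s)) <=
            (C * s `^ (- k))%:E)%E) ->
      {ae lebesgue_measure, forall x : measurableTypeR R,
         posterior_expectation_exists G1 sigma (fun t => t ^+ 2) x} ->
      (marginal_expectation G0 sigma
         (fun x => posterior_expectation G1 sigma (fun t => t) x ^+ 2)%R
       <= Q%:E)%E.
Proof.
(* Strictly between 2 and k: below k for a finite q-th moment, above 2 for Gaussian
   integrability. *)
pose q := (k + 2) / 2.
have q2 : 2 < q by rewrite /q; lra.
have qk : q < k by rewrite /q; lra.
have q0 : 0 < q by lra.
(* The q-th moment bound, with 2 C because both tails count. *)
pose M := 1 + 2 * C * 2 `^ q / (1 - 2 `^ (q - k)).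
have M0 : 0 < M.
  rewrite ltr_pwDl// divr_ge0 ?mulr_ge0 ?powR_ge0 ?(ltW hC)// subr_ge0 ltW//.
  by rewrite /powR pnatr_eq0/= expR_lt1 nmulr_rlt0 ?subr_lt0// ln_gt0 ?ltr1n.
pose A := 2 * expR (2 / q * (ln M + V / 2) + (q + 2) / (q * (q - 2)))
       / Num.sqrt (1 - 2 * ((q + 2) / (4 * q))).
have A0 : 0 <= A by rewrite divr_ge0// mulr_ge0// expR_ge0.
pose S : R := (Num.sqrt (1 - 2 * 4^-1))^-1.
have S0 : 0 <= S by rewrite invr_ge0.
(* [A] bounds the exponential case. In the other case s^2 <= 1 + t^2 turns 8 t^2 + 2 V + 32 s^2 into
   at most 2 V + 32 + 40 t^2, and the last term integrates to at most 40 V. *)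
exists (A + (2 * V + 32) * S + 40 * S * V).
move=> s G0 G1 s0 E0 V0 E1 V1 tail _.
have G0V := integral_sqr_le_variance _ _ E0 V0.
have G1V := integral_sqr_le_variance _ _ E1 V1.
have I2 := integrable_sqr _ _ G1V.
have R1 : \int[G1]_t t = 0 by rewrite /Rintegral -[RHS]/(fine 0%E) -E1 expectation.unlock.
have R2 : \int[G1]_t (t ^+ 2) <= V.
  by rewrite -lee_fin /Rintegral fineK//; exact: integrable_fin_num.
have EM : (\int[G1]_t (`|t| `^ q)%:E <= M%:E)%E.
  apply: (moment_le_tail _ _ k) => //; first by rewrite mulr_ge0// ltW.
  by move=> u u0; rewrite -mulrA; exact/tail_le_law_cdf/tail.
have B0 : 0 <= (2 * V + 32) * S by rewrite mulr_ge0//; lra.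
apply: le_trans (integral_affine_sqr_le G0 _ _ _ _ _ G0V); last 2 first.
- exact: addr_ge0.
- exact: mulr_ge0.
rewrite /marginal_expectation; apply: le_integral_nonmeasurable => t.
  by apply: expectation_ge0 => x; exact: sqr_ge0.
have t2 := sqr_ge0 t.
have [/andP[s1 ts]|small] := boolP ((1 <= s) && (`|t| <= s)).
  apply: le_trans (expectation_posterior_mean_sqr_exp _ _ _ _ _ _ s1 ts q2 M0
    I2 R1 R2 EM) _.
  rewrite lee_fin -/A -addrA lerDl addr_ge0//.
  by rewrite mulr_ge0// mulr_ge0.
apply: le_trans (expectation_posterior_mean_sqr_quadratic _ _ _ _ s0 I2 R1 R2) _.
have st : s ^+ 2 <= 1 + t ^+ 2.
  move: small; rewrite negb_and -!ltNge => /orP[s1|ts].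
    by nra.
  have : s ^+ 2 <= `|t| ^+ 2 by rewrite lerXn2r ?nnegrE// ltW.
  by rewrite real_normK ?num_real//; lra.
rewrite lee_fin -/S.
have -> : A + (2 * V + 32) * S + 40 * S * t ^+ 2 =
  A + (2 * V + 32 + 40 * t ^+ 2) * S by ring.
rewrite -[leLHS]add0r lerD// ler_wpM2r//; lra.
Qed.
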